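(* Let $D$ be a database and let $\Sigma$ be a finite set of simple linear TGDs. Let $d = |\mathsf{sch}(\Sigma)|\cdot \mathsf{ar}(\Sigma)$ and $f_{\mathsf{SL}}(\Sigma) = (d+1)\cdot \|\Sigma\|^{2\cdot \mathsf{ar}(\Sigma)\cdot (d+1)}$. The following are equivalent: (1) $\Sigma \in \mathsf{CT}_D$, i.e., $\mathsf{chase}(D,\Sigma)$ is finite. (2) $|\mathsf{chase}(D,\Sigma)| \le |D|\cdot f_{\mathsf{SL}}(\Sigma)$. (3) $\Sigma$ is $D$-weakly-acyclic.
   Context: **Basics.** $\mathbf{C},\mathbf{N},\mathbf{V}$ are disjoint countably infinite sets of constants, nulls and variables; their elements are terms. A schema is a finite set of predicates, each with an arity $>0$. An atom is $R(\bar t)$ with $\bar t$ a tuple of terms of length the arity of $R$; a fact is an atom with only constants. An instance is a (possibly infinite) set of atoms over constants and nulls; a database is a finite set of facts. $|\cdot|$ is cardinality. A homomorphism from a set of atoms $A$ to a set of atoms $B$ maps terms of $A$ to terms of $B$, is the identity on $\mathbf{C}$, and maps atoms of $A$ to atoms of $B$. **TGDs.** A TGD $\sigma$ is a constant-free sentence $\forall\bar x\forall\bar y(\phi(\bar x,\bar y)\to\exists\bar z\,\psi(\bar x,\bar z))$ with $\phi$ (the body) and $\psi$ (the head) non-empty conjunctions of atoms over the variables $\bar x\cup\bar y$ and $\bar x\cup\bar z$; conjunctions are identified with sets of atoms. The frontier $\mathsf{fr}(\sigma)$ is the set of variables $\bar x$ occurring in both body and head. A TGD is simple linear if its body is a single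 atom in which no variable occurs more than once. For a finite set $\Sigma$ of TGDs (no two sharing a variable), $\mathsf{sch}(\Sigma)$ is the set of predicates occurring in $\Sigma$, $\mathsf{ar}(\Sigma)$ their maximum arity, $\mathsf{atoms}(\Sigma)$ the set of atoms occurring in the TGDs of $\Sigma$, and $\|\Sigma\| = |\mathsf{atoms}(\Sigma)|\cdot|\mathsf{sch}(\Sigma)|\cdot\mathsf{ar}(\Sigma)$. **Semi-oblivious chase.** A trigger for $\Sigma$ on an instance $I$ is $(\sigma,h)$ with $\sigma\in\Sigma$ and $h$ a homomorphism from $\mathsf{body}(\sigma)$ to $I$. Its result $\mathsf{result}(\sigma,h)$ is $\mu(\mathsf{head}(\sigma))$, where $\mu(x)=h(x)$ if $x\in\mathsf{fr}(\sigma)$ and otherwise $\mu(x)$ is the null $\bot^x_{\sigma,h_{|\mathsf{fr}(\sigma)}}$, uniquely determined by $x$, $\sigma$ and the restriction of $h$ to $\mathsf{fr}(\sigma)$. The trigger is active if $\mathsf{result}(\sigma,h)\not\subseteq I$; applying it yields $I\cup\mathsf{result}(\sigma,h)$. A valid chase derivation of $D$ w.r.t. $\Sigma$ is a sequence of instances starting with $D$, each next one obtained by applying an active trigger, that is either finite with no active trigger on the last instance, or infinite and fair (every trigger active on some $I_i$ is not active on some later $I_j$). Its result is the union of its instances; all valid derivations have the same result, denoted $\mathsf{chase}(D,\Sigma)$. $\mathsf{CT}_D$ is the class of sets $\Sigma$ of TGDs such that $\mathsf{chase}(D,\Sigma)$ is finite. **Non-uniform weak-acyclicity.** The dependency graph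 $\mathsf{dg}(\Sigma)$ is the directed multigraph whose nodes are the positions $(R,i)$ with $R\in\mathsf{sch}(\Sigma)$, $1\le i\le$ arity of $R$, and whose edges are exactly: for each $\sigma\in\Sigma$, each $x\in\mathsf{fr}(\sigma)$ and each position $\pi$ at which $x$ occurs in $\mathsf{body}(\sigma)$, a normal edge from $\pi$ to each position at which $x$ occurs in an atom of $\mathsf{head}(\sigma)$, and a special edge from $\pi$ to each position at which an existentially quantified variable of $\sigma$ occurs in an atom of $\mathsf{head}(\sigma)$. For $R,P\in\mathsf{sch}(\Sigma)$ write $R\to_\Sigma P$ if $R=P$ or some $\sigma\in\Sigma$ has $R$ in its body and $P$ in its head; $\rightsquigarrow_\Sigma$ is the transitive closure of $\to_\Sigma$. A (not necessarily simple, possibly cyclic) path in $\mathsf{dg}(\Sigma)$ is $D$-supported if there are $R(\bar t)\in D$ and a node $(P,i)$ on the path with $R\rightsquigarrow_\Sigma P$. $\Sigma$ is $D$-weakly-acyclic if $\mathsf{dg}(\Sigma)$ has no $D$-supported cycle containing a special edge. *)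

(* Defs.v *)
From HB Require Import structures.
From Stdlib Require Import Relation_Operators.
From mathcomp Require Import all_boot finmap.
From mathcomp Require Import boolp classical_sets functions cardinality.

Set Implicit Arguments.
Unset Strict Implicit.
Unset Printing Implicit Defensive.

Local Open Scope classical_set_scope.
Local Open Scope fset_scope.
Local Open Scope nat_scope.

Record schema := Schema {
  pred_sort :> finType;
  arity : pred_sort -> nat;
  arity_gt0 : forall R, 0 < arity R
}.

(* The countably infinite sets C, N and V. They are copies of nat, kept disjoint
   by typing: the terms of an instance form the sum of C and N, and the atoms of
   a TGD, which is constant-free, are over V. *)
Notation const := nat (only parsing).
Notation null := nat (only parsing).
Notation var := nat (only parsing).
Notation gterm := (nat + nat)%type (only parsing).

Definition atom (S : schema) (T : Type) := {R : S & (arity R).-tuple T}.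

Definition pred_of (S : schema) (T : Type) (a : atom S T) : S := tag a.
Definition args (S : schema) (T : Type) (a : atom S T) :
  (arity (pred_of a)).-tuple T := tagged a.

Definition map_atom (S : schema) (T U : Type) (f : T -> U) (a : atom S T) :
  atom S U := Tagged (fun R : S => (arity R).-tuple U) (map_tuple f (args a)).

Definition database (S : schema) := {fset atom S const}.
Definition instance (S : schema) := set (atom S gterm).

Definition instance_of (S : schema) (D : database S) : instance S :=
  [set map_atom inl a | a in [set` D]]%classic.

Record tgd (S : schema) := TGD {
  body_head : {fset atom S var} * {fset atom S var};
  tgd_nonempty : (body_head.1 != fset0) && (body_head.2 != fset0)
}.
HB.instance Definition _ (S : schema) := [isSub for @body_head S].
HB.instance Definition _ (S : schema) := [Countable of tgd S by <:].

Section TGDs.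
Variable S : schema.
Implicit Types (A : {fset atom S var}) (s : tgd S) (Sigma : {fset tgd S}).

Definition tgd_body s : {fset atom S var} := (body_head s).1.
Definition tgd_head s : {fset atom S var} := (body_head s).2.

Definition vars A : {fset var} :=
  \bigcup_(a <- A) [fset x in (args a : seq var)].

Definition frontier s : {fset var} := vars (tgd_body s) `&` vars (tgd_head s).
Definition existentials s : {fset var} := vars (tgd_head s) `\` vars (tgd_body s).

Definition simple_linear s : Prop :=
  exists2 a, tgd_body s = [fset a] & uniq (args a).

Definition variable_disjoint Sigma : Prop :=
  forall s t, s \in Sigma -> t \in Sigma -> s != t ->
  [disjoint vars (tgd_body s `|` tgd_head s) & vars (tgd_body t `|` tgd_head t)].

Definition atoms Sigma : {fset atom S var} :=
  \bigcup_(s <- Sigma) (tgd_body s `|` tgd_head s).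
Definition sch Sigma : {fset S} := [fset pred_of a | a in atoms Sigma].
Definition ar Sigma : nat := \max_(R <- sch Sigma) arity R.
Definition tgds_norm Sigma : nat :=
  #|` atoms Sigma| * #|` sch Sigma| * ar Sigma.

Definition f_SL Sigma : nat :=
  let d := #|` sch Sigma| * ar Sigma in
  (d + 1) * tgds_norm Sigma ^ (2 * ar Sigma * (d + 1)).

End TGDs.

Section Chase.
Variable S : schema.
Implicit Types (s : tgd S) (Sigma : {fset tgd S}) (h : var -> gterm).
Implicit Types (D : database S) (I J C : instance S).

(* [A] has no constants, so every map on its variables is the identity on C; a
   homomorphism is represented by a map on all variables, of which only the
   values on [vars A] matter. *)
Definition homomorphism h (A : {fset atom S var}) I : Prop :=
  forall a, a \in A -> I (map_atom h a).

Definition frontier_map s h : {fmap var -> gterm} :=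
  [fmap y : frontier s => h (val y)].

(* [pickle] is injective, so distinct triples name distinct nulls. *)
Definition null_of (x : var) s h : null :=
  choice.pickle (x, s, frontier_map s h).

Definition mu s h (x : var) : gterm :=
  if x \in frontier s then h x else inr (null_of x s h).

Definition result s h : instance S :=
  [set map_atom (mu s h) a | a in [set` tgd_head s]]%classic.

Definition trigger Sigma I s h : Prop :=
  s \in Sigma /\ homomorphism h (tgd_body s) I.

Definition active Sigma I s h : Prop :=
  trigger Sigma I s h /\ ~ (result s h `<=` I)%classic.

Definition chase_step Sigma I J : Prop :=
  exists s h, active Sigma I s h /\ J = (I `|` result s h)%classic.

Definition finite_valid_derivation D Sigma (I_ : nat -> instance S) (n : nat) :=
  [/\ I_ 0 = instance_of D,
      forall i, i < n -> chase_step Sigma (I_ i) (I_ i.+1) &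
      forall s h, ~ active Sigma (I_ n) s h].

Definition infinite_valid_derivation D Sigma (I_ : nat -> instance S) :=
  [/\ I_ 0 = instance_of D,
      forall i, chase_step Sigma (I_ i) (I_ i.+1) &
      forall i s h, active Sigma (I_ i) s h ->
        exists2 j, i < j & ~ active Sigma (I_ j) s h].

Definition chase_result D Sigma C : Prop :=
  (exists (I_ : nat -> instance S) n,
                finite_valid_derivation D Sigma I_ n /\
                C = (\bigcup_(i in [set i | i <= n]) I_ i)%classic) \/
  (exists I_ : nat -> instance S, infinite_valid_derivation D Sigma I_ /\
              C = (\bigcup_i I_ i)%classic).

(* The default [set0] is never used: see [chaseP] and [chaseE]. *)
Definition chase D Sigma : instance S := xget set0 (chase_result D Sigma).

Definition CT D : set {fset tgd S} :=
  [set Sigma | finite_set (chase D Sigma)]%classic.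

Lemma chase_step_sub Sigma I J : chase_step Sigma I J -> (I `<=` J)%classic.
Proof. by move=> [s [h [_ ->]]]; exact: subsetUl. Qed.

Lemma seq_sub (I_ : nat -> instance S) n :
  (forall i, i < n -> I_ i `<=` I_ i.+1)%classic ->
  forall i j, i <= j -> j <= n -> (I_ i `<=` I_ j)%classic.
Proof.
move=> step i; elim=> [|j IHj]; first by rewrite leqn0 => /eqP-> _ a.
rewrite leq_eqVlt => /orP[/eqP-> _ a //|le_ij] lt_jn.
exact: subset_trans (IHj le_ij (ltnW lt_jn)) (step _ lt_jn).
Qed.

Lemma trigger_sub Sigma I J s h :
  (I `<=` J)%classic -> trigger Sigma I s h -> trigger Sigma J s h.
Proof. by move=> sub_IJ [s_in hom]; split=> // a /hom /sub_IJ. Qed.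

Definition sat Sigma I : Prop :=
  forall s h, trigger Sigma I s h -> (result s h `<=` I)%classic.

Lemma chase_result_sat D Sigma C : chase_result D Sigma C ->
  (instance_of D `<=` C)%classic /\ sat Sigma C.
Proof.
case=> [[I_ [n [[I0 step stop] ->]]]|[I_ [[I0 step fair] ->]]].
  have mono := seq_sub (fun i lt_in => chase_step_sub (step i lt_in)).
  have -> : (\bigcup_(i in [set i | i <= n]) I_ i = I_ n)%classic.
    apply/seteqP; split=> [a [i /= le_in]|a Ia]; last by exists n => /=.
    exact: mono.
  split=> [|s h tr]; first by rewrite -I0; exact: mono.
  by apply: contrapT => nsub; apply: (stop s h); split.
split=> [a Da|s h [s_in hom]]; first by exists 0 => //; rewrite I0.
have mono i j : i <= j -> (I_ i `<=` I_ j)%classic.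
  by move=> le_ij; apply: (@seq_sub _ j) => // k _; exact: chase_step_sub.
have [i hom_i] : exists i, homomorphism h (tgd_body s) (I_ i).
  have /boolp.choice [f fP] : forall a, exists i, a \in tgd_body s -> I_ i (map_atom h a).
    move=> a; case: (boolP (a \in tgd_body s)) => [/hom[i _ Ii]|_]; last by exists 0.
    by exists i.
  exists (\max_(a <- tgd_body s) f a) => a a_in; apply: mono (fP _ a_in).
  exact: leq_bigmax_seq.
have tr_i : trigger Sigma (I_ i) s h by [].
have [act|/not_andP[//|/contrapT sub]] := pselect (active Sigma (I_ i) s h); last first.
  by move=> a /sub; exists i.
have [j lt_ij /not_andP[nt|/contrapT sub]] := fair _ _ _ act.
  by case: nt; apply: trigger_sub tr_i; exact/mono/ltnW.
by move=> a /sub; exists j.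
Qed.

Lemma chase_result_min D Sigma C J : chase_result D Sigma C ->
  (instance_of D `<=` J)%classic -> sat Sigma J -> (C `<=` J)%classic.
Proof.
move=> resC sub_DJ satJ.
have stepJ I I' : chase_step Sigma I I' -> (I `<=` J -> I' `<=` J)%classic.
  move=> [s [h [[tr _] ->]]] sub_IJ; rewrite subUset; split=> //.
  exact/satJ/(trigger_sub sub_IJ tr).
case: resC => [[I_ [n [[I0 step _] ->]]]|[I_ [[I0 step _] ->]]] a [i /= le_in Ia].
  suff : (I_ i `<=` J)%classic by apply.
  elim: i le_in {Ia} => [|i IHi] lt_in; first by rewrite I0.
  exact: stepJ (step i lt_in) (IHi (ltnW lt_in)).
suff : (I_ i `<=` J)%classic by apply.
elim: i {le_in Ia} => [|i IHi]; first by rewrite I0.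
exact: stepJ (step i) IHi.
Qed.

Lemma chase_result_uniq D Sigma C C' :
  chase_result D Sigma C -> chase_result D Sigma C' -> C = C'.
Proof.
move=> resC resC'; have [DC satC] := chase_result_sat resC.
have [DC' satC'] := chase_result_sat resC'.
by apply/seteqP; split; [exact: chase_result_min DC' satC'|exact: chase_result_min DC satC].
Qed.

Lemma args_vars (A : {fset atom S var}) a x :
  a \in A -> x \in (args a : seq var) -> x \in vars A.
Proof. by move=> aA xa; apply/bigfcupP; exists a; rewrite ?aA// inE. Qed.

Lemma map_atom_ext (T U : choiceType) (f g : T -> U) (a : atom S T) :
  {in (args a : seq T), f =1 g} -> map_atom f a = map_atom g a.
Proof.
move=> fg; rewrite /map_atom; congr (Tagged _ _).
by apply/val_inj/eq_in_map.
Qed.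

Lemma active_ext Sigma I s h h' : {in vars (tgd_body s), h =1 h'} ->
  active Sigma I s h -> active Sigma I s h'.
Proof.
move=> hh'; have frE : frontier_map s h = frontier_map s h'.
  apply/fmapP => y; rewrite /frontier_map.
  case: (boolP (y \in frontier s)) => [yfr|yNfr]; last by rewrite !not_fnd.
  by rewrite !in_fnd !ffunE /= hh' //; move: yfr; rewrite in_fsetI => /andP[].
have muE : mu s h = mu s h'.
  apply: funext => x; rewrite /mu /null_of frE; case: ifP => // xfr.
  by rewrite hh' //; move: xfr; rewrite in_fsetI => /andP[].
have resE : result s h = result s h' by rewrite /result muE.
rewrite /active resE => -[[s_in hom] nsub]; split=> //; split=> // a a_in.
rewrite -(map_atom_ext (f := h)); first exact: hom.
by move=> x xa; apply: hh'; apply: args_vars xa.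
Qed.

Lemma chase_result_ex D Sigma : exists C, chase_result D Sigma C.
Proof.
pose ext (m : {fmap var -> gterm}) (x : var) : gterm := odflt (inl 0) m.[? x]%fmap.
pose decode n : option (tgd S * {fmap var -> gterm}) := choice.unpickle n.
pose act I n := if decode n is Some (s, m) then active Sigma I s (ext m) else False.
pose res n := if decode n is Some (s, m) then result s (ext m) else set0.
have code s h : exists n, forall I, active Sigma I s h -> act I n.
  pose m : {fmap var -> gterm} := [fmap y : vars (tgd_body s) => h (val y)].
  exists (choice.pickle (s, m)) => I; rewrite /act /decode choice.pickleK.
  apply: active_ext => x xb; have xm : x \in domf m := xb.
  by rewrite /ext (in_fnd xm) ffunE.
have nextP I : exists J, (exists n, act I n) ->
  exists n, [/\ act I n, forall k, act I k -> n <= k & J = (I `|` res n)%classic].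
  have [[n actn]|nact] := pselect (exists n, act I n); last by exists I => /nact.
  have ex : exists n, `[< act I n >] by exists n; apply/asboolP.
  exists (I `|` res (ex_minn ex))%classic => _; exists (ex_minn ex).
  case: ex_minnP => k /asboolP actk min; split=> // l actl.
  by apply: min; apply/asboolP.
have [next {}nextP] := boolp.choice nextP.
pose I_ n := iter n next (instance_of D).
have step i : (exists n, act (I_ i) n) -> chase_step Sigma (I_ i) (I_ i.+1).
  move=> /nextP[n [actn _ E]]; rewrite /= E.
  move: actn; rewrite /act /res; case: (decode n) => [[s m]|//] actn.
  by exists s, (ext m).
have [[n stop]|nstop] := pselect (exists n, ~ exists k, act (I_ n) k).
  have ex : exists n, `[< ~ exists k, act (I_ n) k >] by exists n; apply/asboolP.
  case: (ex_minnP ex) => {stop}k /asboolP stop min.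
  exists (\bigcup_(i in [set i | i <= k]) I_ i)%classic; left; exists I_, k.
  split=> //; split=> // [i lt_ik|s h acth]; last first.
    by apply: stop; have [c cP] := code s h; exists c; exact: cP.
  apply: step; apply: contrapT => stopi.
  have /min : `[< ~ exists k, act (I_ i) k >] by apply/asboolP.
  by rewrite leqNgt lt_ik.
have go i : exists k, act (I_ i) k by apply: contrapT => ngo; apply: nstop; exists i.
exists (\bigcup_i I_ i)%classic; right; exists I_; split=> //.
split=> // [i|i s h _]; first exact: step.
have [k kP] := code s h; apply: contrapT => unfair.
have actk j : i < j -> act (I_ j) k.
  by move=> lt_ij; apply: kP; apply: contrapT => nact; apply: unfair; exists j.
have mono m n : m <= n -> (I_ m `<=` I_ n)%classic.
  by move=> le_mn; apply: (@seq_sub _ n) => // l _; exact: chase_step_sub (step l (go l)).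
have [c cP] := boolp.choice (fun j => nextP (I_ j) (go j)).
have c_le j : i < j -> c j <= k by move=> /actk; have [_ + _] := cP j; apply.
have c_neq j l : j < l -> c j <> c l.
  move=> lt_jl Ec; have [_ _ Ej] := cP j; have [actl _ _] := cP l.
  have : (res (c l) `<=` I_ l)%classic.
    by apply: subset_trans (mono _ _ lt_jl); rewrite /= Ej Ec; exact: subsetUr.
  by move: actl; rewrite /act /res; case: (decode _) => [[t m] []|].
pose f (t : 'I_k.+2) : 'I_k.+1 := inord (c (i.+1 + t)).
have f_inj : injective f.
  move=> t u /(congr1 val); rewrite /= !inordK ?ltnS ?c_le ?leq_addr // => Ec.
  apply/val_inj; case: (ltngtP t u) => // [lt|lt].
    by case: (c_neq (i.+1 + t) (i.+1 + u)); rewrite // ltn_add2l.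
  by case: (c_neq (i.+1 + u) (i.+1 + t)); rewrite // ltn_add2l.
by have := leq_card f f_inj; rewrite !card_ord ltnn.
Qed.

Lemma chaseP D Sigma : chase_result D Sigma (chase D Sigma).
Proof. exact: xgetPex (chase_result_ex D Sigma). Qed.

Lemma chaseE D Sigma C : chase_result D Sigma C -> chase D Sigma = C.
Proof. exact: chase_result_uniq (chaseP D Sigma). Qed.

End Chase.

Section WeakAcyclicity.
Variable S : schema.
Implicit Types (s : tgd S) (Sigma : {fset tgd S}) (D : database S).

Definition position := {R : S & 'I_(arity R)}.

Definition occurs_at (A : {fset atom S var}) (x : var) (p : position) : Prop :=
  exists2 a, a \in A & exists i : 'I_(arity (pred_of a)),
    p = Tagged (fun R : S => 'I_(arity R)) i /\ tnth (args a) i = x.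

(* An edge is a source, a flag telling whether it is special, and a target.
   Parallel edges of the same kind are merged, which does not affect the
   existence of cycles with given nodes and edge kinds. *)
Definition edge := (position * bool * position)%type.
Definition src (e : edge) : position := e.1.1.
Definition special (e : edge) : bool := e.1.2.
Definition tgt (e : edge) : position := e.2.

Variant dg Sigma : edge -> Prop :=
| dg_normal s x p q of
    s \in Sigma & x \in frontier s &
    occurs_at (tgd_body s) x p & occurs_at (tgd_head s) x q :
    dg Sigma (p, false, q)
| dg_special s x z p q of
    s \in Sigma & x \in frontier s & z \in existentials s &
    occurs_at (tgd_body s) x p & occurs_at (tgd_head s) z q :
    dg Sigma (p, true, q).

(* A path is given by its sequence of consecutive edges; the [cycle] of path.v
   also requires the last edge to lead to the first one. *)
Definition dg_cycle Sigma (c : seq edge) : Prop :=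
  (forall e, e \in c -> dg Sigma e) /\ cycle (fun e f => tgt e == src f) c.

Definition on_path (c : seq edge) (p : position) : Prop :=
  exists2 e, e \in c & p = src e \/ p = tgt e.

Definition pred_step Sigma (R P : S) : Prop :=
  [/\ R \in sch Sigma, P \in sch Sigma &
      R = P \/ exists s, [/\ s \in Sigma,
                             exists2 a, a \in tgd_body s & pred_of a = R &
                             exists2 b, b \in tgd_head s & pred_of b = P]].

Definition pred_reach Sigma : S -> S -> Prop := clos_trans S (pred_step Sigma).

Definition supported D Sigma (c : seq edge) : Prop :=
  exists a p, [/\ a \in D, on_path c p & pred_reach Sigma (pred_of a) (tag p)].

Definition weakly_acyclic D Sigma : Prop :=
  ~ exists c, [/\ dg_cycle Sigma c, supported D Sigma c &
                  exists2 e, e \in c & special e].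

End WeakAcyclicity.

(* Main.v *)
Require Import Defs.
From Stdlib Require Import Relation_Operators Transitive_Closure.
From mathcomp Require Import all_boot finmap.
From mathcomp Require Import boolp classical_sets functions cardinality.

(** A cycle through a special edge forces an infinite chase: bodies are single
    atoms without repeated variables, so any atom whose predicate is that of a
    position on the cycle can be pushed around the cycle, and each turn replaces
    the value at the position by a null created, directly or indirectly, from
    it. Nulls of the chase are well-founded under creation, hence these values
    are pairwise distinct.

    Conversely, let the rank of a position [p] be the number of positions from
    which a walk with a special edge leads to [p]. Under weak acyclicity, ranks
    of positions reachable from [D] are smaller than [d], do not decrease along
    edges and increase along special ones. Starting from a fact of [D] as the
    only atom of level 0, let level [n + 1] consist of the results of TGDs whose
    frontier is mapped into the terms of a single atom of level [n]. For every
    [k], the terms at the positions of rank less than [k] in a chase atom all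
    occur in one atom of level at most [k]; with [k = d], every chase atom is
    over the terms of one atom of level at most [d]. A level is at most
    [N ^ (2 * ar)] times larger than the previous one, where [N] is the norm of
    the set of TGDs, and at most [N ^ (2 * ar)] atoms are over the terms of a
    given one. *)

Local Open Scope card_scope.

Section Proof.
Set Implicit Arguments.
Unset Strict Implicit.
Unset Printing Implicit Defensive.
Local Open Scope fset_scope.
Local Open Scope nat_scope.

Notation gterm := (nat + nat)%type.

Variable S : schema.
Implicit Types (Sigma : {fset tgd S}) (D : database S) (s : tgd S).
Implicit Types (p q : position S) (e : edge S) (c : seq (edge S)).

(** * Predicates, variables and nulls of TGDs *)

Lemma mem_atoms Sigma s a :
  s \in Sigma -> a \in tgd_body s `|` tgd_head s -> a \in atoms Sigma.
Proof. by move=> sS aS; apply/bigfcupP; exists s; rewrite ?sS. Qed.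

Lemma mem_sch Sigma a : a \in atoms Sigma -> pred_of a \in sch Sigma.
Proof. by move=> aS; apply/imfsetP; exists a. Qed.

Lemma body_sch Sigma s a : s \in Sigma -> a \in tgd_body s ->
  pred_of a \in sch Sigma.
Proof. by move=> sS ab; apply/mem_sch/(mem_atoms sS); rewrite in_fsetU ab. Qed.

Lemma head_sch Sigma s a : s \in Sigma -> a \in tgd_head s ->
  pred_of a \in sch Sigma.
Proof.
by move=> sS ah; apply/mem_sch/(mem_atoms sS); rewrite in_fsetU ah orbT.
Qed.

Lemma arity_le_ar Sigma R : R \in sch Sigma -> arity R <= ar Sigma.
Proof. by move=> RS; apply: leq_bigmax_seq. Qed.

Lemma mem_varsP (A : {fset atom S nat}) x :
  reflect (exists2 a, a \in A & x \in (args a : seq nat)) (x \in vars A).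
Proof.
rewrite /vars; apply: (iffP (bigfcupP _ _ _ _)) => [[a]|[a aA xa]].
  by rewrite andbT inE => aA xa; exists a.
by exists a; rewrite ?aA ?inE.
Qed.

Lemma frontier_map_eq s h h' : frontier_map s h = frontier_map s h' ->
  {in frontier s, h =1 h'}.
Proof.
move=> E x xf; have := congr1 (fun m : {fmap nat -> gterm} => m.[? x]%fmap) E.
by rewrite !in_fnd !ffunE => -[].
Qed.

Lemma mu_eq s h h' : {in frontier s, h =1 h'} -> mu s h = mu s h'.
Proof.
move=> hh'; have frE : frontier_map s h = frontier_map s h'.
  apply/fmapP => y; case: (boolP (y \in frontier s)) => [yf|yNf].
    by rewrite !in_fnd !ffunE /= hh'.
  by rewrite !not_fnd.
apply: funext => x; rewrite /mu /null_of frE.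
by case: ifP => // xf; rewrite hh'.
Qed.

(** * Walks in the dependency graph *)

Lemma dgP Sigma p b q : dg Sigma (p, b, q) -> exists s x,
  [/\ s \in Sigma, x \in frontier s, occurs_at (tgd_body s) x p &
      if b then exists2 z, z \in existentials s & occurs_at (tgd_head s) z q
      else occurs_at (tgd_head s) x q].
Proof.
move E : (p, b, q) => e H.
by case: H E => [s x ? ? ? ? ? ?|s x z ? ? ? ? ? ? ?] [-> -> ->]; exists s, x;
  split=> //; exists z.
Qed.

(** With explicit endpoints, a walk can be empty at a given node, and walks can be concatenated. *)
Fixpoint linked q c p :=
  if c is e :: c' then (q == src e) && linked (tgt e) c' p else q == p.

Lemma path_linked e c f :
  path (fun e f => tgt e == src f) e (rcons c f) = linked (tgt e) c (src f).
Proof. by elim: c e => [|g c IHc] e /=; rewrite ?andbT // IHc. Qed.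

Lemma linked_cat q c1 p c2 r :
  linked q c1 p -> linked p c2 r -> linked q (c1 ++ c2) r.
Proof.
elim: c1 q => [|e c1 IHc] q /=; first by move=> /eqP->.
by move=> /andP[-> /IHc].
Qed.

Definition special_walk Sigma q p := exists c,
  [/\ forall e, e \in c -> dg Sigma e, linked q c p & has (@special S) c].

Lemma special_walk_edge Sigma q p b r : special_walk Sigma q p ->
  dg Sigma (p, b, r) -> special_walk Sigma q r.
Proof.
move=> [c [cS cl cs]] pr; exists (rcons c (p, b, r)); split.
- by move=> e; rewrite mem_rcons inE => /predU1P[->|/cS].
- by rewrite -cats1; apply: linked_cat cl _; rewrite /= !eqxx.
- by rewrite has_rcons cs orbT.
Qed.

Lemma special_edge_walk Sigma p q :
  dg Sigma (p, true, q) -> special_walk Sigma p q.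
Proof.
move=> pq; exists [:: (p, true, q)]; split=> //= [e|]; last by rewrite !eqxx.
by rewrite inE => /eqP->.
Qed.

(** A walk with a special edge is non-empty, so its first edge has source [p]; being closed, it is a
    cycle supported through [p] itself. *)
Lemma weakly_acyclic_walk D Sigma a p : weakly_acyclic D Sigma ->
  a \in D -> pred_reach Sigma (pred_of a) (tag p) -> ~ special_walk Sigma p p.
Proof.
move=> wa aD reach [[|e c] [cS cl /hasP[f fc fs]]] //; apply: wa.
exists (e :: c); move: cl => /= /andP[/eqP pe cl]; split; last by exists f.
  by split; rewrite //= path_linked -pe.
by exists a, p; split=> //; exists e; rewrite ?mem_head ?pe; last by left.
Qed.

(** * A special cycle makes the chase infinite *)

(** The creation order: [t] is one of the frontier values recorded in the name of the null [u]. No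
    instance is involved. *)
Definition child (t u : gterm) := exists s h x z,
  [/\ x \in frontier s, t = h x & u = inr (null_of z s h)].

Lemma null_of_eq z z' s s' h h' : null_of z s h = null_of z' s' h' ->
  s = s' /\ {in frontier s, h =1 h'}.
Proof.
move=> /(pcan_inj choice.pickleK) E.
have ss' : s = s' := congr1 (fun u => u.1.2) E.
split=> //; move: (congr1 snd E); rewrite /= -ss'.
exact: frontier_map_eq.
Qed.

Lemma child_ind (P : gterm -> Prop) s h z :
  (forall x, x \in frontier s -> P (h x)) ->
  forall t, child t (inr (null_of z s h)) -> P t.
Proof.
move=> hP t [s' [h' [x [z' [xf -> E]]]]].
have /null_of_eq[ss' hh'] : null_of z s h = null_of z' s' h' by case: E.
by rewrite -ss' in xf; rewrite -hh' //; exact: hP.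
Qed.

(** By minimality of the chase, it suffices that accessibility is preserved: constants have no
    parents, and the parents of a new null are frontier values, which occur in the image of the
    body. *)
Lemma chase_Acc D Sigma a t :
  chase D Sigma a -> t \in (args a : seq gterm) -> Acc child t.
Proof.
pose J : instance S :=
  fun a => forall t, t \in (args a : seq gterm) -> Acc child t.
suff sub : (chase D Sigma `<=` J)%classic by move=> /sub /[apply].
apply: chase_result_min (chaseP D Sigma) _ _.
  move=> _ [b _ <-] u /mapP[x _ ->]; constructor => v.
  by move=> [s [h [y [z [_ _]]]]].
move=> s h [sS hom] _ [b bh <-] u /mapP[x xb ->].
have acc y : y \in frontier s -> Acc child (h y).
  move=> /fsetIP[/mem_varsP[a' aB ya] _]; apply: (hom _ aB).
  exact: map_f.
rewrite /mu; case: ifP => [/acc //|_].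
by constructor; apply: child_ind.
Qed.

Lemma Acc_irrefl (T : Type) (R : T -> T -> Prop) t :
  Acc R t -> ~ clos_trans T R t t.
Proof.
move=> acc; have {}acc := @Acc_clos_trans _ _ _ acc.
by elim: {t} acc => t _ IH tt; exact: (IH t tt tt).
Qed.

(** Typing the tuple by the predicate of [p] avoids transport along an equality of predicates. *)
Definition holds (I : instance S) p (v : gterm) : Prop :=
  exists2 t : (arity (tag p)).-tuple gterm,
    I (Tagged (fun R : S => (arity R).-tuple gterm) t) & tnth t (tagged p) = v.

Lemma holds_map (I : instance S) (A : {fset atom S nat}) (f : nat -> gterm) x q :
  occurs_at A x q -> ([set map_atom f a | a in [set` A]] `<=` I)%classic ->
  holds I q (f x).
Proof.
move=> [b bA [i [-> <-]]] sub; exists (map_tuple f (args b)); last exact: tnth_map.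
by apply: sub; exists b.
Qed.

(** As no variable repeats, each body variable can take the value at its own index, so every tuple
    matches the body. The default value only concerns variables outside the body. *)
Lemma simple_linear_trigger (I : instance S) Sigma s a
    (t : (arity (pred_of a)).-tuple gterm) :
  s \in Sigma -> tgd_body s = [fset a] -> uniq (args a) ->
  I (Tagged (fun R : S => (arity R).-tuple gterm) t) ->
  exists2 h, trigger Sigma I s h & map_tuple h (args a) = t.
Proof.
move=> sS bs ua It; pose h x := nth (inl 0) t (index x (args a)).
have ht : map_tuple h (args a) = t.
  apply: eq_from_tnth => i; rewrite tnth_map /h (tnth_nth 0) index_uniq //.
    by rewrite -tnth_nth.
  by rewrite size_tuple.
exists h => //; split=> // b; rewrite bs inE => /eqP->.
by rewrite /map_atom ht.
Qed.

Section Unbounded.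
Variables (D : database S) (Sigma : {fset tgd S}).
Hypothesis Sigma_SL : forall s, s \in Sigma -> simple_linear s.
Let C := chase D Sigma.

(** An atom with [v] at [p] yields a trigger, under which the chase is closed. A normal edge copies
    [v]; on a special edge [v] is a parent of the null put at [q]. *)
Lemma holds_edge p b q v : dg Sigma (p, b, q) -> holds C p v ->
  exists2 w, holds C q w & if b then child v w else v = w.
Proof.
have [_ satC] := chase_result_sat (chaseP D Sigma).
move=> /dgP[s [x [sS xf [a ab [i [-> xi]]] tq]]] [t Ct <-].
have [a' bs ua] := Sigma_SL sS; move: (ab); rewrite bs inE => /eqP aa'; subst a'.
have [h /satC sub ht] := simple_linear_trigger sS bs ua Ct.
have -> : tnth t i = h x by rewrite -xi -ht tnth_map.
case: b tq => [[z zx]|] /holds_map/(_ sub); last by rewrite /mu xf; exists (h x).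
have /negPf zf : z \notin frontier s.
  by move: zx; rewrite !inE negb_and => /andP[-> _].
by rewrite /mu zf => H; exists (inr (null_of z s h)) => //; exists s, h, x, z.
Qed.

Lemma holds_walk c p q v : (forall e, e \in c -> dg Sigma e) -> linked p c q ->
  holds C p v -> exists2 w, holds C q w &
  if has (@special S) c then clos_trans _ child v w
  else v = w \/ clos_trans _ child v w.
Proof.
elim: c p v => [|[[p' b] r] c IHc] p v cS /=.
  by move=> /eqP-> pv; exists v => //; left.
move=> /andP[/eqP-> rc] pv.
have [|u ru vu] := holds_edge (b := b) (q := r) _ pv.
  by apply: cS; rewrite mem_head.
have [|w qw uw] := IHc r u _ rc ru.
  by move=> e ec; apply: cS; rewrite inE ec orbT.
exists w => //; move: vu uw; rewrite /special /=; case: (b) => /= [vu|-> //].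
have {}vu := @t_step _ child _ _ vu.
case: ifP => _ => [|[<- //|]]; exact: t_trans vu.
Qed.

Lemma holds_reach R P : pred_reach Sigma R P ->
  (exists2 a, C a & pred_of a = R) -> exists2 a, C a & pred_of a = P.
Proof.
have [_ satC] := chase_result_sat (chaseP D Sigma).
elim=> {R P} [_ _ [_ _ [->//|[s [sS [a ab <-] [b bh <-]]]]]|R Q P _ IH1 _ IH2 /IH1/IH2//].
move=> [a' Ca' aa']; have [a0 bs ua] := Sigma_SL sS.
move: (ab); rewrite bs inE => /eqP ?; subst a0.
case: a' Ca' aa' => R t Ct /= Ra; subst R.
have [h /satC sub _] := simple_linear_trigger sS bs ua Ct.
by exists (map_atom (mu s h) b) => //; apply: sub; exists b.
Qed.

Lemma finite_chase_weakly_acyclic : finite_set C -> weakly_acyclic D Sigma.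
Proof.
move=> finC [c [[cS cc] [a [p [aD [f fc pf] reach]]] [e ec es]]].
(* The cycle is rotated to begin with the edge [f] that touches the supporting position [p]. *)
have [i c' Ec] := rot_to fc.
have cS' g : g \in f :: c' -> dg Sigma g by rewrite -Ec mem_rot; exact: cS.
have cl : linked (src f) (f :: c') (src f).
  by rewrite /= eqxx -path_linked -(rot_cycle i) Ec in cc *.
have hs : has (@special S) (f :: c').
  by rewrite -Ec has_rot; apply/hasP; exists e.
have [subD _] := chase_result_sat (chaseP D Sigma).
have [v0 fv0] : exists v, holds C (src f) v.
  have [|[R t] Ct /= Rp] := holds_reach reach.
    by exists (map_atom inl a) => //; apply: subD; exists a.
  have [v pv] : exists v, holds C p v.
    by subst R; exists (tnth t (tagged p)), t.
  (* If [p] is the target of [f], the rest [c'] of the cycle leads from it back to the source of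
     [f]. *)
  have [ps|pt] := pf; first by rewrite ps in pv; exists v.
  have cS'' g : g \in c' -> dg Sigma g.
    by move=> gc; apply: cS'; rewrite inE gc orbT.
  move: cl => /= /andP[_ cl]; rewrite pt in pv.
  by have [w fw _] := holds_walk cS'' cl pv; exists w.
have next v : exists w, holds C (src f) v -> holds C (src f) w /\ clos_trans _ child v w.
  have [fv|nfv] := pselect (holds C (src f) v); last by exists v.
  by have := holds_walk cS' cl fv; rewrite hs => -[w fw vw]; exists w.
have [g gP] := boolp.choice next; pose V n := iter n g v0.
have hV n : holds C (src f) (V n) by elim: n => //= n /gP[].
have ltV m n : m < n -> clos_trans _ child (V m) (V n).
  elim: n => // n IHn; rewrite ltnS leq_eqVlt => /predU1P[->|/IHn mn].
    by have [] := gP _ (hV n).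
  by apply: t_trans mn _; have [] := gP _ (hV n).
have irr n : ~ clos_trans _ child (V n) (V n).
  have [t Ct Vn] := hV n; apply/Acc_irrefl/(chase_Acc Ct).
  by rewrite -Vn mem_tnth.
have finV : finite_set (range V).
  apply: (@sub_finite_set _ _ (\bigcup_(b in C) [set` (args b : seq gterm)])%classic).
    move=> _ [n _ <-]; have [t Ct Vn] := hV n.
    by exists (Tagged (fun R : S => (arity R).-tuple gterm) t) => //=; rewrite -Vn mem_tnth.
  by apply: bigcup_finite => // b _; exact: finite_seq.
have Vinj : injective V.
  move=> m n Vmn; case: (ltngtP m n) => // [/ltV|/ltV]; rewrite Vmn => /irr //.
apply: infinite_nat; apply: (card_le_finite _ finV).
by rewrite (card_le_eqr (inj_card_eq _)) // => m n _ _; exact: Vinj.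
Qed.

End Unbounded.

(** * Ranks of positions *)

Definition special_ancestors Sigma p : {pred position S} :=
  fun q => `[< special_walk Sigma q p >].

Lemma special_ancestorsP Sigma p q :
  reflect (special_walk Sigma q p) (q \in special_ancestors Sigma p).
Proof. by rewrite unfold_in; exact: asboolP. Qed.

Definition rank Sigma p : nat := #|special_ancestors Sigma p|.

Lemma rank_edge Sigma p b q : dg Sigma (p, b, q) -> rank Sigma p <= rank Sigma q.
Proof.
move=> pq; apply/subset_leq_card/fintype.subsetP => r /special_ancestorsP rp.
by apply/special_ancestorsP; exact: special_walk_edge rp pq.
Qed.

(** The position [p] is an ancestor of [q] but, by acyclicity, not of itself. *)
Lemma rank_special_edge Sigma p q : ~ special_walk Sigma p p ->
  dg Sigma (p, true, q) -> rank Sigma p < rank Sigma q.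
Proof.
move=> acyc pq; apply/proper_card/fintype.properP; split.
  apply/fintype.subsetP => r /special_ancestorsP rp.
  by apply/special_ancestorsP; exact: special_walk_edge rp pq.
by exists p; apply/special_ancestorsP => //; exact: special_edge_walk.
Qed.

Lemma special_walk_sch Sigma q p : special_walk Sigma q p -> tag q \in sch Sigma.
Proof.
move=> [[|[[q' b] r] c] [cS /= cl //= _]]; move: cl => /andP[/eqP-> _].
have /cS/dgP[s [x [sS _ [a ab [i [-> _]]] _]]] := mem_head (q', b, r) c.
exact: body_sch ab.
Qed.

Lemma rank_lt Sigma p : tag p \in sch Sigma -> ~ special_walk Sigma p p ->
  rank Sigma p < #|` sch Sigma| * ar Sigma.
Proof.
move=> pS acyc; pose A := special_ancestors Sigma p.
pose name (q : position S) : S * nat := (tag q, val (tagged q)).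
have name_inj : injective name.
  move=> [R i] [P j] [/= E]; subst P => ij; congr Tagged; exact: val_inj.
pose names := [seq (R, i) | R <- sch Sigma, i <- iota 0 (ar Sigma)].
have -> : #|` sch Sigma| * ar Sigma = size names by rewrite size_allpairs size_iota.
have Np : p \notin A by apply/special_ancestorsP.
(* Counting [p] along with its ancestors, to which it does not belong, makes the bound strict. *)
have -> : (rank Sigma p).+1 = size [seq name q | q <- enum [predU1 p & A]].
  by rewrite size_map -cardE cardU1 Np.
apply: uniq_leq_size; first by rewrite map_inj_uniq ?enum_uniq.
move=> _ /mapP[q + ->]; rewrite mem_enum => qA.
have qS : tag q \in sch Sigma.
  by move: qA; rewrite inE => /predU1P[->//|/special_ancestorsP/special_walk_sch].
apply: allpairs_f => //; rewrite mem_iota add0n.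
exact: leq_trans (ltn_ord _) (arity_le_ar qS).
Qed.

(** * Levels *)

Fixpoint seqs_over (T : Type) (l : seq T) n : seq (seq T) :=
  if n is m.+1 then [seq x :: w | x <- l, w <- seqs_over l m] else [:: [::]].

Lemma size_seqs_over (T : Type) (l : seq T) n : size (seqs_over l n) = size l ^ n.
Proof. by elim: n => //= n IHn; rewrite size_allpairs IHn expnS. Qed.

Lemma mem_seqs_over (T : eqType) (l w : seq T) :
  {subset w <= l} -> w \in seqs_over l (size w).
Proof.
elim: w => [|x w IHw] sub //=; apply: allpairs_f; first exact/sub/mem_head.
by apply: IHw => y yw; apply: sub; rewrite inE yw orbT.
Qed.

Lemma size_flatten_map_leq (T : eqType) (U : Type) (F : T -> seq U) l k :
  {in l, forall x, size (F x) <= k} -> size (flatten (map F l)) <= size l * k.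
Proof.
elim: l => //= x l IHl lk; rewrite size_cat mulSn leq_add ?lk ?mem_head //.
by apply: IHl => y yl; apply: lk; rewrite inE yl orbT.
Qed.

(** The values in [w] follow the enumeration of [frontier s]; [mu s] never reads the default, which
    is taken outside the frontier. *)
Definition frontier_assignment s (w : seq gterm) (x : nat) : gterm :=
  nth (inl 0) w (index x (frontier s)).

(** The frontier ranges over all tuples of terms of [g], whether or not they come from a match of
    the body, so that the size is easy to bound. *)
Definition offspring Sigma (g : atom S gterm) : seq (atom S gterm) :=
  flatten [seq flatten [seq [seq map_atom (mu s (frontier_assignment s w)) b
                              | b <- tgd_head s]
                         | w <- seqs_over (args g : seq gterm) #|` frontier s|]
            | s <- Sigma].

Lemma mem_offspring Sigma g s h b : s \in Sigma -> b \in tgd_head s ->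
  (forall x, x \in frontier s -> h x \in (args g : seq gterm)) ->
  map_atom (mu s h) b \in offspring Sigma g.
Proof.
move=> sS bh hg; apply/flatten_mapP; exists s => //.
apply/flatten_mapP; exists [seq h x | x <- frontier s].
  rewrite -(size_map h); apply: mem_seqs_over => _ /mapP[x xf ->]; exact: hg.
rewrite (@mu_eq s h (frontier_assignment s [seq h x | x <- frontier s])).
  exact: map_f.
move=> x xf; rewrite /frontier_assignment (nth_map 0) ?index_mem //.
by rewrite nth_index.
Qed.

Lemma offspring_sch Sigma g b : b \in offspring Sigma g ->
  pred_of b \in sch Sigma.
Proof.
move=> /flatten_mapP[s sS /flatten_mapP[w _ /mapP[a ah ->]]].
exact: head_sch ah.
Qed.

Definition level Sigma g n : seq (atom S gterm) :=
  iter n (fun l => flatten [seq offspring Sigma b | b <- l]) [:: g].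

Lemma mem_level_succ Sigma g n b b' : b \in level Sigma g n ->
  b' \in offspring Sigma b -> b' \in level Sigma g n.+1.
Proof. by move=> bn b'b; apply/flatten_mapP; exists b. Qed.

Lemma level_sch Sigma g n b : pred_of g \in sch Sigma ->
  b \in level Sigma g n -> pred_of b \in sch Sigma.
Proof.
case: n => [|n] gS /=; first by rewrite inE => /eqP->.
by move=> /flatten_mapP[b' _]; exact: offspring_sch.
Qed.

Definition atoms_over Sigma (g : atom S gterm) : seq (atom S gterm) :=
  flatten [seq [seq Tagged (fun R : S => (arity R).-tuple gterm)
                      [tuple nth (inl 0) w i | i < arity R]
                 | w <- seqs_over (args g : seq gterm) (arity R)]
            | R <- sch Sigma].

Lemma mem_atoms_over Sigma g b : pred_of b \in sch Sigma ->
  {subset (args b : seq gterm) <= (args g : seq gterm)} -> b \in atoms_over Sigma g.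
Proof.
case: b => R t /= RS sub; apply/flatten_mapP; exists R => //.
apply/mapP; exists (t : seq gterm).
  by have := mem_seqs_over sub; rewrite size_tuple.
by congr Tagged; apply: eq_from_tnth => i; rewrite tnth_mktuple -tnth_nth.
Qed.

(** * Covering chase atoms by levels *)

Definition covered Sigma g b := forall k, exists n g',
  [/\ n <= k, g' \in level Sigma g n &
      forall i : 'I_(arity (pred_of b)),
        rank Sigma (Tagged (fun R : S => 'I_(arity R)) i) < k ->
        tnth (args b) i \in (args g' : seq gterm)].

Lemma covered_refl Sigma g : covered Sigma g g.
Proof.
by move=> k; exists 0, g; split; rewrite ?mem_head // => i _; exact: mem_tnth.
Qed.

(** If a position of rank less than [k] in [b] holds an existential variable, special edges force
    all frontier values to lie at body positions of rank less than [k - 1], hence in one atom of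
    level at most [k - 1], of which the new atom is an offspring. Otherwise normal edges trace every
    position of rank less than [k] to a body position of no larger rank, and the cover of the body
    atom still works. *)
Lemma covered_result Sigma g s h a b : s \in Sigma -> tgd_body s = [fset a] ->
  (forall p, tag p = pred_of a -> ~ special_walk Sigma p p) ->
  b \in tgd_head s ->
  covered Sigma g (map_atom h a) -> covered Sigma g (map_atom (mu s h) b).
Proof.
move=> sS bs acyc bh cov k.
pose pos (c : atom S nat) (i : 'I_(arity (pred_of c))) : position S :=
  Tagged (fun R : S => 'I_(arity R)) i.
have frontier_pos x : x \in frontier s -> exists i, tnth (args a) i = x.
  move=> /fsetIP[/mem_varsP[a' + xa] _]; rewrite bs inE => /eqP a'a; subst a'.
  by have /tnthP[i ->] := xa; exists i.
have at_body i : occurs_at (tgd_body s) (tnth (args a) i) (pos a i).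
  by exists a; rewrite ?bs ?inE //; exists i.
have at_head j : occurs_at (tgd_head s) (tnth (args b) j) (pos b j).
  by exists b => //; exists j.
have [[j [jk jN]]|all_frontier] := pselect
    (exists j, rank Sigma (pos b j) < k /\ tnth (args b) j \notin frontier s).
  (* Since a rank lies below it, [k] is positive; from here on [k] names its predecessor. The new
     atom serves as its own cover. *)
  case: k jk => // k jk; have [n [g' [nk g'n g'P]]] := cov k.
  exists n.+1, (map_atom (mu s h) b); split=> // [|i _]; last exact: mem_tnth.
  apply: mem_level_succ g'n _; apply: mem_offspring => // x xf.
  have [i ix] := frontier_pos x xf.
  have := g'P i; rewrite tnth_map ix; apply.
  apply: leq_trans (_ : rank Sigma (pos b j) <= k) => //.
  apply: rank_special_edge; first exact: acyc.
  apply: (dg_special sS xf (z := tnth (args b) j)); rewrite -?ix //.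
  move: jN; rewrite !inE negb_and (args_vars bh (mem_tnth _ _)) orbF => ->//.
have [n [g' [nk g'n g'P]]] := cov k; exists n, g'; split=> // j jk.
have jf : tnth (args b) j \in frontier s.
  by apply: contrapT => /negP jN; apply: all_frontier; exists j.
have [i ij] := frontier_pos _ jf.
have := g'P i; rewrite !tnth_map ij /mu jf; apply.
apply: leq_ltn_trans jk; apply: rank_edge; apply: (dg_normal sS jf) => //.
by rewrite -ij.
Qed.

Lemma leq_exp2r_weak n k l : k <= l -> k ^ n <= l ^ n.
Proof. by case: n => // n kl; rewrite leq_exp2r. Qed.

(** * The size of the chase *)

Section Bounded.
Variables (D : database S) (Sigma : {fset tgd S}).
Hypothesis Sigma_disjoint : variable_disjoint Sigma.
Hypothesis Sigma_SL : forall s, s \in Sigma -> simple_linear s.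
Hypothesis wa : weakly_acyclic D Sigma.
Let d := #|` sch Sigma| * ar Sigma.

(** Facts with a predicate outside [sch Sigma] match no body and are kept apart, as [pred_reach]
    only relates predicates of [sch Sigma]. *)
Lemma chase_covered b : chase D Sigma b -> exists2 a, a \in D &
  pred_of a \notin sch Sigma /\ b = map_atom inl a \/
  pred_reach Sigma (pred_of a) (pred_of b) /\ covered Sigma (map_atom inl a) b.
Proof.
pose K b := exists2 a, a \in D &
  pred_of a \notin sch Sigma /\ b = map_atom inl a \/
  pred_reach Sigma (pred_of a) (pred_of b) /\ covered Sigma (map_atom inl a) b.
suff sub : (chase D Sigma `<=` K)%classic by move=> /sub.
apply: chase_result_min (chaseP D Sigma) _ _.
  move=> _ [a aD <-]; exists a => //.
  have [aS|aNS] := boolP (pred_of a \in sch Sigma); last by left.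
  by right; split; [apply: t_step; split=> //; left|exact: covered_refl].
move=> {b}s h [sS hom] _ [b bh <-]; have [a bs _] := Sigma_SL sS.
have ab : a \in tgd_body s by rewrite bs inE.
have aS := body_sch sS ab.
have [a' a'D [[a'NS E]|[reach cov]]] := hom _ ab.
  by case/negP: a'NS; have := congr1 (@pred_of S _) E => /= <-.
exists a' => //; right; split.
  apply: t_trans reach _; apply: t_step; split; first exact: aS.
    exact: head_sch bh.
  by right; exists s; split=> //; [exists a|exists b].
apply: covered_result bs _ bh cov => // p pa.
by apply: weakly_acyclic_walk wa a'D _; rewrite pa.
Qed.

Definition candidates (g : atom S gterm) : seq (atom S gterm) :=
  if pred_of g \in sch Sigma then
    flatten [seq flatten [seq atoms_over Sigma g' | g' <- level Sigma g n]
              | n <- iota 0 (d + 1)]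
  else [:: g].

Lemma pred_reach_sch R P :
  pred_reach Sigma R P -> R \in sch Sigma /\ P \in sch Sigma.
Proof. by elim=> [? ? []|? ? ? _ [? _] _ []]. Qed.

Lemma chase_candidates b : chase D Sigma b ->
  exists2 a, a \in D & b \in candidates (map_atom inl a).
Proof.
move=> /chase_covered[a aD [[aNS ->]|[reach cov]]]; exists a => //; rewrite /candidates.
  by rewrite (negPf aNS) mem_head.
have [aS bS] := pred_reach_sch reach; rewrite aS.
(* By [rank_lt] all positions of [b] have rank below [d], so this cover contains every term of
   [b]. *)
have [n [g' [nd g'n g'P]]] := cov d.
apply/flatten_mapP; exists n; first by rewrite mem_iota addn1.
apply/flatten_mapP; exists g' => //; apply: mem_atoms_over => // _ /tnthP[i ->].
by apply: g'P; apply: rank_lt => //; exact: weakly_acyclic_walk wa aD _.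
Qed.

(* Arities are positive, so every body contains a variable and TGDs without
   common variables have different bodies. *)
Lemma card_tgds_le_atoms : #|` Sigma| <= #|` atoms Sigma|.
Proof.
have /boolp.choice[f fP] : forall s, exists a, s \in Sigma -> tgd_body s = [fset a].
  move=> s; case: (boolP (s \in Sigma)) => [/Sigma_SL[a bs _]|_]; first by exists a.
  (* Outside [Sigma] any atom will do as a value of [f]; the non-emptiness of a TGD provides one. *)
  have [A [/fset0Pn[a _] _]] : exists A : {fset atom S nat} * {fset atom S nat},
      A.1 != fset0 /\ A.2 != fset0.
    by exists (body_head s); apply/andP; exact: tgd_nonempty.
  by exists a.
have f_inj : {in Sigma &, injective f}.
  move=> s t sS tS fst; apply: contrapT => /eqP st.
  have /fdisjointP := Sigma_disjoint sS tS st.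
  have [x xf] : exists x, x \in (args (f s) : seq nat).
    by exists (tnth (args (f s)) (Ordinal (arity_gt0 _))); exact: mem_tnth.
  have in_vars u : u \in Sigma -> f s = f u ->
      x \in vars (tgd_body u `|` tgd_head u).
    move=> uS fu; apply/mem_varsP; exists (f s) => //.
    by rewrite in_fsetU (fP _ uS) fu inE eqxx.
  by move=> /(_ x (in_vars s sS erefl)); rewrite in_vars.
rewrite -(card_in_imfset imfset_key f_inj); apply/fsubset_leq_card/fsubsetP.
move=> _ /imfsetP[s sS ->]; apply: (mem_atoms sS).
by rewrite in_fsetU (fP s sS) inE eqxx.
Qed.

Let m := ar Sigma.

(** The factors count TGDs, maps from at most [m] frontier variables to at most [m] terms, and head
    atoms. The TGDs are no more numerous than the atoms, hence the square. *)
Lemma size_offspring g : 0 < m -> pred_of g \in sch Sigma ->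
  size (offspring Sigma g) <= #|` atoms Sigma| ^ 2 * m ^ m.
Proof.
move=> m0 gS.
apply: (@leq_trans (#|` Sigma| * (m ^ m * #|` atoms Sigma|))); last first.
  by rewrite mulnCA mulnC expnS expn1 leq_mul2r leq_mul2r card_tgds_le_atoms !orbT.
apply: size_flatten_map_leq => s sS.
apply: leq_trans (size_flatten_map_leq (k := #|` atoms Sigma|) _) _.
  move=> w _; rewrite size_map; apply/fsubset_leq_card/fsubsetP => b bh.
  by apply: (mem_atoms sS); rewrite in_fsetU bh orbT.
rewrite leq_mul2r size_seqs_over size_tuple; apply/orP; right.
have [a bs _] := Sigma_SL sS.
have fr : #|` frontier s| <= m.
  have aS : pred_of a \in sch Sigma by apply: (body_sch sS); rewrite bs inE.
  apply: leq_trans (arity_le_ar aS); rewrite -(size_tuple (args a)).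
  apply: uniq_leq_size => [|x]; first exact: fset_uniq.
  by move=> /fsetIP[/mem_varsP[b + xb] _]; rewrite bs inE => /eqP <-.
apply: leq_trans (leq_pexp2l m0 fr); apply: leq_exp2r_weak => //.
exact: arity_le_ar.
Qed.

Lemma size_level g n : 0 < m -> pred_of g \in sch Sigma ->
  size (level Sigma g n) <= (#|` atoms Sigma| ^ 2 * m ^ m) ^ n.
Proof.
move=> m0 gS; elim: n => //= n IHn; rewrite expnSr.
apply: leq_trans (leq_mul IHn (leqnn _)); apply: size_flatten_map_leq => b bn.
by apply: size_offspring => //; exact: level_sch bn.
Qed.

Lemma size_atoms_over g : 0 < m -> pred_of g \in sch Sigma ->
  size (atoms_over Sigma g) <= #|` sch Sigma| * m ^ m.
Proof.
move=> m0 gS; apply: size_flatten_map_leq => R RS.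
rewrite size_map size_seqs_over size_tuple.
apply: leq_trans (leq_pexp2l m0 (arity_le_ar RS)); apply: leq_exp2r_weak => //.
exact: arity_le_ar.
Qed.

Lemma sch_gt0 R : R \in sch Sigma ->
  [/\ 0 < #|` atoms Sigma|, 0 < #|` sch Sigma| & 0 < m].
Proof.
move=> RS; split; last exact: leq_trans (arity_gt0 R) (arity_le_ar RS).
  have /imfsetP[a /= aS _] := RS.
  by rewrite cardfs_gt0; apply/fset0Pn; exists a.
by rewrite cardfs_gt0; apply/fset0Pn; exists R.
Qed.

Lemma f_SL_gt0 : 0 < f_SL Sigma.
Proof.
rewrite /f_SL addn1 muln_gt0 /= expn_gt0.
have [E|[R /sch_gt0[A0 P0 m0]]] := fset_0Vmem (sch Sigma).
  (* An empty [sch Sigma] makes [ar Sigma], and hence the exponent, zero. *)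
  by rewrite /tgds_norm /ar E big_seq_fset0 !muln0 orbT.
by rewrite /tgds_norm !muln_gt0 A0 P0 m0.
Qed.

Lemma size_candidates g : size (candidates g) <= f_SL Sigma.
Proof.
rewrite /candidates; case: ifP => [gS|_]; last exact: f_SL_gt0.
have [A0 P0 m0] := sch_gt0 gS; rewrite /f_SL -/d -/m.
pose N := tgds_norm Sigma ^ (2 * m).
have N0 : 0 < N by rewrite expn_gt0 !muln_gt0 A0 P0 m0.
(* The power [N] splits into powers of the three factors of the norm, each bounded separately. *)
have le_N k l : k <= #|` atoms Sigma| ^ (2 * m) -> l <= #|` sch Sigma| ^ (2 * m) ->
    k * l * m ^ m <= N.
  by move=> kA lP; rewrite /N !expnMn !leq_mul ?leq_pexp2l // leq_pmull.
have leN1 : #|` atoms Sigma| ^ 2 * m ^ m <= N.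
  rewrite -[X in X * _]muln1; apply: le_N; last by rewrite expn_gt0 P0.
  by rewrite leq_pexp2l // leq_pmulr.
have leN2 : #|` sch Sigma| * m ^ m <= N.
  rewrite -[X in X * _]mul1n; apply: le_N; first by rewrite expn_gt0 A0.
  by rewrite -[X in X <= _]expn1 leq_pexp2l // muln_gt0.
(* Each of the [d + 1] levels has at most [N ^ d] atoms, and each of these contributes at most [N]
   candidates. *)
apply: leq_trans (size_flatten_map_leq (k := N ^ (d + 1)) _) _; last first.
  by rewrite size_iota -expnM.
move=> n; rewrite mem_iota add0n addn1 ltnS => nd.
apply: leq_trans (size_flatten_map_leq (k := N) _) _ => [g' g'n|].
  apply: leq_trans leN2; apply: size_atoms_over => //.
  exact: level_sch g'n.
rewrite expnSr leq_mul2r; apply/orP; right.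
apply: leq_trans (size_level n m0 gS) _; apply: leq_trans (leq_pexp2l N0 nd).
exact: leq_exp2r_weak.
Qed.

Lemma card_chase_le : (chase D Sigma #<= `I_(#|` D| * f_SL Sigma))%card.
Proof.
pose l := flatten [seq candidates (map_atom inl a) | a <- D].
have sub : (chase D Sigma `<=` [set` l])%classic.
  by move=> b /chase_candidates[a aD ab]; apply/flatten_mapP; exists a.
have size_l : size l <= #|` D| * f_SL Sigma.
  by apply: size_flatten_map_leq => a _; exact: size_candidates.
apply: card_le_trans (subset_card_le sub) _.
apply: card_le_trans (_ : `I_(size l) #<= _)%card; last by rewrite card_le_II.
have idx : {in [set` l]%classic &, injective (index^~ l)}.
  by move=> b c; rewrite !inE => bl cl bc; rewrite -(nth_index b bl) bc nth_index.
rewrite -(card_le_eql (inj_card_eq idx)); apply: subset_card_le.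
by move=> _ [b bl <-]; rewrite /= index_mem.
Qed.

End Bounded.

End Proof.

Theorem theorem6p4 (S : schema) (D : database S) (Sigma : {fset tgd S})
    (Sigma_disjoint : variable_disjoint Sigma)
    (Sigma_SL : forall s, s \in Sigma -> simple_linear s) :
  [<-> CT D Sigma;
       chase D Sigma #<= `I_(#|` D| * f_SL Sigma);
       weakly_acyclic D Sigma].
Proof.
have fin_wa := finite_chase_weakly_acyclic (D := D) Sigma_SL.
have wa_le := card_chase_le (D := D) Sigma_disjoint Sigma_SL.
have le_fin n : chase D Sigma #<= `I_n -> CT D Sigma.
  by move=> leC; apply/finite_set_leP; exists n.
(* The implications at hand run from (1) to (3), to (2), and back to (1); each one required here
   composes two of them. *)
tfae=> [/fin_wa/wa_le//|/le_fin/fin_wa//|/wa_le/le_fin//].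
Qed.
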